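(* Let $\langle \mathcal{S},\mathcal{A},\mathcal{P},r,\gamma\rangle$ be a Markov decision process with returns accumulated up to a horizon $T$, and let the behaviour policy be a Gaussian mixture $\pi_b(a\mid s)=\sum_{i=1}^M\alpha^i(s)\phi^i(a\mid s)$ with mixing coefficients $\alpha^i(s)$ and Gaussian components (modes) $\phi^i(\cdot\mid s)$. Let $\zeta_b(u\mid s)=\alpha^u(s)$ be the behavioural hyper-policy, let $Q_H^{\zeta_b}$ be its hyper Q-function, let $\zeta_g$ be the greedy hyper-policy $\zeta_g(s)=\arg\max_{u\in\{1,\dots,M\}}Q_H^{\zeta_b}(s,u)$, and let $\pi_{\zeta_g}$ be the composite policy induced by $\zeta_g$, i.e. $\pi_{\zeta_g}(a\mid s)=\phi^{\zeta_g(s)}(a\mid s)$. Then the composite policy induced by the greedy hyper-policy improves upon the behaviour policy: $$V^{\pi_{\zeta_g}}(s)\ \ge\ V^{\pi_b}(s)\qquad\text{for all } s\in\mathcal{S}.$$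
   Context: MDP: $\mathcal{S}$ is the state space, $\mathcal{A}$ the action space, $\mathcal{P}(s_{t+1}\mid s_t,a_t)$ the transition dynamics, $r(s,a)$ the reward function, $\gamma$ the discount factor. Trajectories are $s_0,a_0,\dots,s_T,a_T$, where $T$ is the horizon. For a policy $\pi(a\mid s)$, the state-action value function is the expected return starting from state $s_t$, taking action $a_t$, and following $\pi$ thereafter, $$Q^\pi(s_t,a_t)=\mathbb{E}_{s_{t+1},a_{t+1},\dots\sim\pi}\Big[\sum_{l=t}^{T}\gamma^{l-t} r(s_l,a_l)\Big],$$ and the value function is $V^\pi(s_t)=\mathbb{E}_{a_t\sim\pi(\cdot\mid s_t)}[Q^\pi(s_t,a_t)]$. Hyper-MDP: the hyper-action space is $\mathcal{A}_H=\{1,\dots,M\}$, indexing the modes $\phi^1,\dots,\phi^M$, with $$\mathcal{P}_H(s_{t+1}\mid s_t,u_t)=\mathbb{E}_{a_t\sim\phi^{u_t}(\cdot\mid s_t)}[\mathcal{P}(s_{t+1}\mid s_t,a_t)],\qquad r_H(s_t,u_t)=\mathbb{E}_{a_t\sim\phi^{u_t}(\cdot\mid s_t)}[r(s_t,a_t)].$$ A hyper-policy $\zeta(u\mid s)$ maps each state to a probability distribution over $\mathcal{A}_H$. The composite policy induced by $\zeta$ is $\pi_\zeta(a\mid s)=\sum_{u\in\mathcal{A}_H}\zeta(u\mid s)\phi^u(a\mid s)$; in particular $\pi_{\zeta_b}=\pi_b$. The hyper Q-function of $\zeta$ is the expected return when choosing mode $u$ in state $s$ and following $\zeta$ thereafter,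 $$Q_H^\zeta(s,u)=\mathbb{E}\Big[\sum_{t=0}^{T}\gamma^t r_H(s_t,u_t)\,\Big|\,s_0=s,u_0=u\Big],$$ where $s_{t+1}\sim\mathcal{P}_H(\cdot\mid s_t,u_t)$ and, for $t\ge1$, $u_t\sim\zeta(\cdot\mid s_t)$.
   Formalization: For a finite horizon T the greedy hyper-policy may depend on the stage t and maximizes the hyper Q-value of the remaining steps (a single stationary argmax can fail); returns are assumed absolutely integrable; for infinite T, gamma < 1 and bounded rewards are assumed. *)

(* Defs.v *)
From HB Require Import structures.
From mathcomp Require Import all_boot all_order all_algebra.
From mathcomp Require Import all_classical all_reals all_analysis.
From mathcomp Require Import measurable_realfun.

Set Implicit Arguments.
Unset Strict Implicit.
Unset Printing Implicit Defensive.

Import Order.TTheory GRing.Theory Num.Theory.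
Import numFieldNormedType.Exports.

Local Open Scope classical_set_scope.
Local Open Scope ring_scope.

(* Modes are indexed by 'I_M.+1 (measurable types are pointed in the library,
   and a mixture has at least one component), with the discrete
   sigma-algebra. *)
HB.instance Definition _ (M : nat) := isPointed.Build 'I_M.+1 ord0.
HB.instance Definition _ (M : nat) :=
  @isMeasurable.Build default_measure_display 'I_M.+1
    discrete_measurable discrete_measurable0
    discrete_measurableC discrete_measurableU.

Lemma measurable_mode_pair d (T : measurableType d) (M : nat)
    (A : set (T * 'I_M.+1)) :
  (forall u, measurable [set x | A (x, u)]) -> measurable A.
Proof.
move=> mA.
rewrite (_ : A = \big[setU/set0]_(u < M.+1) ([set x | A (x, u)] `*` [set u])).
  by apply: bigsetU_measurable => u _; exact: measurableX.
rewrite -bigcup_mkord_ord; apply/seteqP; split => [[x u] Axu|[x u]].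
  by exists (val u) => //=; rewrite inord_val.
by move=> [i _ [/= + ->]].
Qed.

Section kernel_constructions.
Context {R : realType}.

Section pkcomp.
Context {d1 d2 d3} {X : measurableType d1} {Y : measurableType d2}
  {Z : measurableType d3}.
Variables (l : R.-pker X ~> Y) (k : R.-pker (X * Y) ~> Z).

(* The library's composition [l \; k], as a probability kernel. *)
Definition pkcomp : X -> {measure set Z -> \bar R} := (l \; k)%E.

Let pkcomp_measurable U : measurable U ->
  measurable_fun [set: X] (pkcomp ^~ U).
Proof. exact: measurable_fun_mkcomp_sfinite. Qed.

HB.instance Definition _ := isKernel.Build _ _ X Z R pkcomp pkcomp_measurable.

Let pkcomp_prob x : pkcomp x [set: Z] = 1%E.
Proof.
rewrite /pkcomp /= /kcomp.
under eq_integral do rewrite prob_kernel.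
by rewrite integral_cst// mul1e; exact: prob_kernel.
Qed.

HB.instance Definition _ :=
  Kernel_isProbability.Build _ _ X Z R pkcomp pkcomp_prob.

End pkcomp.

Section kpre.
Context {d0 d1 d2} {W : measurableType d0} {X : measurableType d1}
  {Y : measurableType d2}.
Variables (k : R.-pker X ~> Y) (f : W -> X).

Definition kpre of measurable_fun [set: W] f :
  W -> {measure set Y -> \bar R} := fun w => k (f w).

Hypothesis mf : measurable_fun [set: W] f.

Let kpre_measurable U : measurable U ->
  measurable_fun [set: W] (kpre mf ^~ U).
Proof. by move=> mU; exact: measurableT_comp (measurable_kernel k U mU) mf. Qed.

HB.instance Definition _ := isKernel.Build _ _ W Y R (kpre mf) kpre_measurable.

Let kpre_prob w : kpre mf w [set: Y] = 1%E.
Proof. exact: prob_kernel. Qed.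

HB.instance Definition _ :=
  Kernel_isProbability.Build _ _ W Y R (kpre mf) kpre_prob.

End kpre.

End kernel_constructions.

Section mdp.
Context {R : realType} {dS dA : measure_display}
  {S : measurableType dS} {A : measurableType dA}.
Variables (P : R.-pker (S * A) ~> S) (r : S * A -> R) (gamma : R).
Variable pi : nat -> R.-pker S ~> A.

Let next (w : ((S * A) * S) * A) : S * A := (w.1.2, w.2).

Let measurable_next : measurable_fun [set: _] next.
Proof.
apply: measurable_fun_pair => /=; last exact: measurable_snd.
exact: measurableT_comp measurable_snd measurable_fst.
Qed.

Let glue n (w : (((S * A) * S) * A) * n.+1.-tuple (S * A)) :
  n.+2.-tuple (S * A) := [tuple of w.1.1.1 :: w.2].

Let measurable_glue n : measurable_fun [set: _] (@glue n).
Proof.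
apply: measurable_cons; last exact: measurable_snd.
exact: measurableT_comp measurable_fst
  (measurableT_comp measurable_fst measurable_fst).
Qed.

Let measurable_start : measurable_fun [set: S * A] (fun x => [tuple x]).
Proof. by apply: measurable_cons => //; exact: measurable_cst. Qed.

(* The law of ((s_t, a_t), ..., (s_(t+n), a_(t+n))) given (s_t, a_t), where the
   action at stage l > t is drawn from [pi l]; see [trajS] for the recursion in
   closed form. *)
Fixpoint traj (n t : nat) : R.-pker (S * A) ~> n.+1.-tuple (S * A) :=
  match n with
  | 0 => kdirac measurable_start
  | n'.+1 =>
      pkcomp P
        (pkcomp (kpre (pi t.+1) measurable_snd)
           (pkcomp (kpre (traj n' t.+1) measurable_next)
              (kdirac (@measurable_glue n'))))
  end.

Lemma traj0 t x B : traj 0 t x B = (\d_[tuple x] B)%E.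
Proof. by []. Qed.

Lemma trajS n t x B : measurable B ->
  traj n.+1 t x B =
  (\int[P x]_s' \int[pi t.+1 s']_a'
     traj n t.+1 (s', a') [set tau : n.+1.-tuple (S * A) | B [tuple of x :: tau]])%E.
Proof.
move=> mB; rewrite /= /pkcomp /= /kcomp.
apply: eq_integral => s' _; apply: eq_integral => a' _ /=.
rewrite /kcomp /kpre /= /next /=.
under eq_integral do rewrite /kdirac/= /glue/= diracE.
set C := [set tau : n.+1.-tuple (S * A) | B [tuple of x :: tau]].
have mC : measurable C.
  have mx : measurable_fun [set: n.+1.-tuple (S * A)]
      (fun tau => [tuple of x :: tau]).
    by apply: measurable_cons => //; exact: measurable_cst.
  by rewrite -[C]setTI; exact: mx.
transitivity (\int[traj n t.+1 (s', a')]_tau (\1_C tau)%:E)%E.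
  apply: eq_integral => tau _; rewrite indicE; congr (_%:R%:E).
by rewrite integral_indic// setIT.
Qed.

Definition disc_return n (tau : n.+1.-tuple (S * A)) : R :=
  \sum_(k < n.+1) gamma ^+ k * r (tnth tau k).

(* Stages run over t <= N for the horizon T = [Some N], and over all t for the
   infinite horizon T = [None]. The value at stage t is the expected return
   accumulated from stage t up to the horizon, so for a finite horizon it depends
   on t; for the infinite horizon it is the limit of the expected returns over n
   further stages, and does not depend on t when [pi] is stationary. *)
Definition Qfun (T : option nat) (t : nat) (x : S * A) : \bar R :=
  let Q n := (\int[traj n t x]_tau (disc_return tau)%:E)%E in
  match T with
  | Some N => Q (N - t)%N
  | None => limn Q
  end.

Definition Vfun (T : option nat) (t : nat) (s : S) : \bar R :=
  (\int[pi t s]_a Qfun T t (s, a))%E.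

End mdp.

Definition in_horizon (T : option nat) (t : nat) : bool :=
  if T is Some N then (t <= N)%N else true.

Section hyper_mdp.
Context {R : realType} {dS dA : measure_display}
  {S : measurableType dS} {A : measurableType dA} {M : nat}.
Variables (P : R.-pker (S * A) ~> S) (r : S * A -> R).
Variable phi : 'I_M.+1 -> R.-pker S ~> A.

(* (s, u) |-> phi^u(. | s) *)
Definition mode_kernel : S * 'I_M.+1 -> {measure set A -> \bar R} :=
  fun x => phi x.2 x.1.

Let mode_kernel_measurable U : measurable U ->
  measurable_fun [set: S * 'I_M.+1] (mode_kernel ^~ U).
Proof.
move=> mU _ B mB; rewrite setTI; apply: measurable_mode_pair => u.
rewrite -[X in measurable X]setTI.
exact: (measurable_kernel (phi u) U mU measurableT B mB).
Qed.

HB.instance Definition _ :=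
  isKernel.Build _ _ _ _ R mode_kernel mode_kernel_measurable.

Let mode_kernel_prob x : mode_kernel x [set: A] = 1%E.
Proof. exact: prob_kernel. Qed.

HB.instance Definition _ :=
  Kernel_isProbability.Build _ _ _ _ R mode_kernel mode_kernel_prob.

Definition composite (zeta : R.-pker S ~> 'I_M.+1) : R.-pker S ~> A :=
  pkcomp zeta mode_kernel.

Lemma compositeE zeta s B : measurable B ->
  composite zeta s B = (\sum_(u < M.+1) zeta s [set u] * phi u s B)%E.
Proof.
move=> mB; rewrite /composite /pkcomp /= /kcomp /=.
have -> : [set: 'I_M.+1] = \big[setU/set0]_(u <- enum 'I_M.+1) [set u].
  apply/seteqP; split => // u _.
  by rewrite -bigcup_seq; exists u => //=; rewrite mem_enum.
rewrite ge0_integral_bigsetU//=.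
- rewrite big_enum/=; apply: eq_bigr => u _.
  rewrite (eq_integral (cst (phi u s B))).
    by rewrite integral_cst// muleC.
  by move=> v; rewrite inE => ->.
- exact: enum_uniq.
- by move=> i j _ _ [v [/= -> ->]].
Qed.

Lemma composite_kdirac (g : S -> 'I_M.+1) (mg : measurable_fun [set: S] g) s B :
  measurable B -> composite (kdirac mg) s B = phi (g s) s B.
Proof.
move=> mB; rewrite /composite /pkcomp /= /kcomp /=.
by rewrite integral_dirac// diracT mul1e.
Qed.

Let state_action (w : (S * 'I_M.+1) * A) : S * A := (w.1.1, w.2).

Let measurable_state_action : measurable_fun [set: _] state_action.
Proof.
apply: measurable_fun_pair => /=; last exact: measurable_snd.
exact: measurableT_comp measurable_fst measurable_fst.
Qed.

Definition hyper_trans : R.-pker (S * 'I_M.+1) ~> S :=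
  pkcomp mode_kernel (kpre P measurable_state_action).

Lemma hyper_transE s u B :
  hyper_trans (s, u) B = (\int[phi u s]_a P (s, a) B)%E.
Proof. by []. Qed.

Definition hyper_reward (x : S * 'I_M.+1) : R :=
  (\int[phi x.2 x.1]_a r (x.1, a))%R.

End hyper_mdp.

Section gaussian.
Context {R : realType}.

(* Lebesgue integral over R^d of a nonnegative measurable function, as an
   iterated integral. *)
Fixpoint integral_Rd (d : nat) : (d.-tuple R -> \bar R) -> \bar R :=
  match d with
  | 0 => fun f => f [tuple]
  | d'.+1 => fun f => (\int[@lebesgue_measure R]_x
                        integral_Rd (fun v => f [tuple of x :: v]))%E
  end.

Definition pos_def d (C : 'M[R]_d) : Prop :=
  C^T = C /\ forall v : 'rV[R]_d, v != 0 -> 0 < (v *m C *m v^T) ord0 ord0.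

Definition gaussian_pdf d (m : 'rV[R]_d) (C : 'M[R]_d) (a : d.-tuple R) : R :=
  let v := \row_i tnth a i - m in
  expR (- (v *m invmx C *m v^T) ord0 ord0 / 2) /
  Num.sqrt ((2 * trigo.pi) ^+ d * \det C).

Definition is_gaussian d (m : 'rV[R]_d) (C : 'M[R]_d)
    (mu : set (d.-tuple R) -> \bar R) : Prop :=
  pos_def C /\ forall B, measurable B ->
    mu B = integral_Rd (fun a => (\1_B a * gaussian_pdf m C a)%:E).

End gaussian.

(* Main.v *)
(* The hyper Q-function of zeta_b at (s, u) is the mean of Q^{pi_b}(s, .) under
   phi^u, so V^{pi_b}(s) is the zeta_b-mean of Q_H(s, .), hence at most
   Q_H(s, zeta_g(s)), the mean of Q^{pi_b}(s, .) under pi_{zeta_g}. By the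
   Bellman equation an inequality V^{pi_b} <= V^{pi_{zeta_g}} + e at stage t + 1
   thus yields one with gamma * e at stage t: induct backwards from a finite
   horizon with e = 0, or let the error gamma^k K tend to 0 for an infinite one.

   Rewards are split as r = p - q with p, q >= 0, the Bellman recursion is run on
   the [0, +oo]-valued returns of p and q, and V^{pi_b} <= V^{pi_{zeta_g}} is
   written V_b(p) + V_g(q) <= V_g(p) + V_b(q). No integrability is then needed
   except to cancel the means of Q^{pi_b} under pi_{zeta_g}. *)
Require Import Defs.
From HB Require Import structures.
From mathcomp Require Import all_boot all_order all_algebra.
From mathcomp Require Import all_classical all_reals all_analysis.
From mathcomp Require Import measurable_realfun zify lra.

Set Implicit Arguments.
Unset Strict Implicit.
Unset Printing Implicit Defensive.

Import Order.TTheory GRing.Theory Num.Theory.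
Import numFieldNormedType.Exports.

Local Open Scope classical_set_scope.
Local Open Scope ring_scope.

(** * Bellman recursion for rewards with values in [0, +oo] *)

Section nonneg_values.
Context {R : realType} {dX dY : measure_display}
  {X : measurableType dX} {Y : measurableType dY}.
Variables (P : R.-pker (X * Y) ~> X) (gamma : R).
Hypothesis gamma0 : 0 <= gamma.
Local Open Scope ereal_scope.

Implicit Types (f : X * Y -> \bar R) (W : X -> \bar R) (k : R.-pker X ~> Y).

Definition act k f (s : X) : \bar R := \int[k s]_a f (s, a).

Definition bellman f W (x : X * Y) : \bar R :=
  f x + gamma%:E * \int[P x]_s W s.

Lemma act_ge0 k f s : (forall x, 0 <= f x) -> 0 <= act k f s.
Proof. by move=> f0; exact: integral_ge0. Qed.

Lemma measurable_act k f : (forall x, 0 <= f x) -> measurable_fun setT f ->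
  measurable_fun setT (act k f).
Proof. by move=> f0 mf; exact: measurable_fun_integral_sfinite_kernel. Qed.

Lemma bellman_ge0 f W x :
  (forall x, 0 <= f x) -> (forall s, 0 <= W s) -> 0 <= bellman f W x.
Proof.
move=> f0 W0; apply: adde_ge0 => //; apply: mule_ge0; first by rewrite lee_fin.
exact: integral_ge0.
Qed.

Lemma measurable_bellman f W : measurable_fun setT f ->
  (forall s, 0 <= W s) -> measurable_fun setT W ->
  measurable_fun setT (bellman f W).
Proof.
move=> mf W0 mW; apply: emeasurable_funD => //; apply: measurable_funeM.
by apply: measurable_fun_integral_kernel => // U mU; exact: measurable_kernel.
Qed.

Lemma le_act k f g s : (forall x, 0 <= f x) -> measurable_fun setT f ->
  (forall x, 0 <= g x) -> measurable_fun setT g -> (forall x, f x <= g x) ->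
  act k f s <= act k g s.
Proof.
by move=> f0 mf g0 mg fg; apply: ge0_le_integral => //;
  exact: measurableT_comp.
Qed.

Lemma le_bellman f g W W' x : f x <= g x ->
  (forall s, 0 <= W s) -> measurable_fun setT W ->
  (forall s, 0 <= W' s) -> measurable_fun setT W' -> (forall s, W s <= W' s) ->
  bellman f W x <= bellman g W' x.
Proof.
move=> fg W0 mW W0' mW' WW'; apply: leeD => //; apply: lee_wpmul2l.
  by rewrite lee_fin.
exact: ge0_le_integral.
Qed.

Variable pi : nat -> R.-pker X ~> Y.

(** The expected discounted return of the reward [f] over the stages t, ..., t + n, given by
    recursion on values instead of by a law on trajectories; [integral_disc_return] identifies the
    two. The policy depends on the stage because a greedy choice for a finite horizon does. *)
Fixpoint Qn f n t : X * Y -> \bar R :=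
  if n is n'.+1 then bellman f (act (pi t.+1) (Qn f n' t.+1)) else f.

(* [f] is nonnegative, so [Qn f n t x] is monotone in [n]: the limit exists in
   [0, +oo]. *)
Definition QT f (T : option nat) t x : \bar R :=
  if T is Some N then Qn f (N - t) t x else limn (fun n => Qn f n t x).

Section props.
Variable f : X * Y -> \bar R.
Hypotheses (f0 : forall x, 0 <= f x) (mf : measurable_fun setT f).

Lemma Qn_ge0 n t x : 0 <= Qn f n t x.
Proof.
elim: n t x => [|n IH] t x //=; apply: bellman_ge0 => // s.
by apply: act_ge0 => y; exact: IH.
Qed.
Local Hint Resolve Qn_ge0 : core.

Lemma measurable_Qn n t : measurable_fun setT (Qn f n t).
Proof.
elim: n t => [|n IH] t //=; apply: measurable_bellman => //.
  by move=> s; exact: act_ge0.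
exact: measurable_act.
Qed.
Local Hint Resolve measurable_Qn : core.

Lemma Qn_ge n t x : f x <= Qn f n t x.
Proof.
case: n => [|n] //=; rewrite /bellman leeDl// mule_ge0 ?lee_fin//.
by apply: integral_ge0 => s _; exact: act_ge0.
Qed.

Lemma le_Qn n t x : Qn f n t x <= Qn f n.+1 t x.
Proof.
elim: n t x => [|n IH] t x; first exact: (@Qn_ge 1).
have gt0 m s : 0 <= act (pi t.+1) (Qn f m t.+1) s by exact: act_ge0.
have mt m : measurable_fun setT (act (pi t.+1) (Qn f m t.+1)).
  exact: measurable_act.
rewrite [leRHS]/(bellman f (act (pi t.+1) (Qn f n.+1 t.+1)) x).
apply: le_bellman => // s; apply: le_act => //.
Qed.

Lemma nondecreasing_Qn t x : nondecreasing_seq (fun n => Qn f n t x).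
Proof. by apply/nondecreasing_seqP => n; exact: le_Qn. Qed.

Lemma Qn_cvg t x : Qn f n t x @[n --> \oo] --> QT f None t x.
Proof.
exact: ereal_nondecreasing_is_cvgn (@nondecreasing_Qn t x).
Qed.

Lemma QT_ge T t x : f x <= QT f T t x.
Proof.
case: T => [N|]; first exact: Qn_ge.
apply: lime_ge; first exact: Qn_cvg.
by exists 0%N => // n _; exact: Qn_ge.
Qed.

Lemma QT_ge0 T t x : 0 <= QT f T t x.
Proof. exact: le_trans (QT_ge T t x). Qed.
Local Hint Resolve QT_ge0 : core.

Lemma measurable_QT T t : measurable_fun setT (QT f T t).
Proof.
case: T => [N|]; first exact: measurable_Qn.
apply: (emeasurable_fun_cvg (fun n => Qn f n t)); first by move=> n.
by move=> x _; exact: Qn_cvg.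
Qed.
Local Hint Resolve measurable_QT : core.

Lemma act_QT_cvg k t s :
  act k (Qn f n t) s @[n --> \oo] --> act k (QT f None t) s.
Proof.
apply: cvg_monotone_convergence => //.
- by move=> n; exact: measurableT_comp.
- by move=> a _; exact: nondecreasing_Qn.
Qed.

Lemma nondecreasing_act_Qn k t s :
  nondecreasing_seq (fun n => act k (Qn f n t) s).
Proof. by move=> m n mn; apply: le_act => // x; exact: nondecreasing_Qn. Qed.

(** The value still to be collected from stage t on. The explicit 0 past the horizon matters: at t =
    N + 1 the truncated N - t is 0 and [QT] would return [f]. With it, one Bellman equation covers
    the last stage as well. *)
Definition tail T t s : \bar R :=
  if in_horizon T t then act (pi t) (QT f T t) s else 0.

Lemma tail_ge0 T t s : 0 <= tail T t s.
Proof. by rewrite /tail; case: ifPn => // _; exact: act_ge0. Qed.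

Lemma measurable_tail T t : measurable_fun setT (tail T t).
Proof.
rewrite /tail; case: (in_horizon T t); last exact: measurable_cst.
exact: measurable_act.
Qed.

(** For a finite horizon this is one unfolding of [Qn]. For the infinite one, the recursion passes
    to the limit by monotone convergence, first over actions and then over next states. *)
Lemma QT_bellman T t x : in_horizon T t ->
  QT f T t x = bellman f (tail T t.+1) x.
Proof.
case: T => [N /= tN|_].
  rewrite /QT; move: (tN); rewrite leq_eqVlt => /predU1P[->|ltN].
    rewrite subnn /= /bellman integral0_eq ?mule0 ?adde0// => s _.
    by rewrite /tail /= ltnn.
  rewrite -[(N - t)%N]prednK ?subn_gt0// -subnS /=; congr bellman.
  by apply/funext => s; rewrite /tail /= ltN.
(* Shifting the sequence by one stage exposes a Bellman step in every term. *)
apply/cvg_lim => //; rewrite -cvg_shiftS /= /bellman.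
apply: cvgeD.
- by rewrite ge0_adde_def// inE// mule_ge0 ?lee_fin// integral_ge0// => s _; exact: tail_ge0.
- exact: cvg_cst.
(* The limit over actions is written as a pointwise limit in s, the form in which monotone
   convergence applies under [P]. *)
- have -> : tail None t.+1 = fun s => limn (fun n => act (pi t.+1) (Qn f n t.+1) s).
    by apply/funext => s; apply/esym/cvg_lim => //; exact: act_QT_cvg.
  apply: cvgeZl => //; apply: cvg_monotone_convergence => //.
  + by move=> n; exact: measurable_act.
  + by move=> n s _; exact: act_ge0.
  + by move=> s _; exact: nondecreasing_act_Qn.
Qed.

Lemma Qn_le_QT n t x : Qn f n t x <= QT f None t x.
Proof.
apply: lime_ge; first exact: Qn_cvg.
by exists n => // m /= nm; exact: nondecreasing_Qn.
Qed.

Lemma act_cst k (c : R) s : act k (fun=> c%:E) s = c%:E.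
Proof. by rewrite /act integral_cst// prob_kernel mule1. Qed.

(** The constant K = C / (1 - gamma) solves K = C + gamma K, so it is a fixed point of the Bellman
    step with reward C and bounds every [Qn] by induction. *)
Lemma QT_ub (C : R) : (gamma < 1)%R -> (forall x, f x <= C%:E) ->
  forall t x, QT f None t x <= (C / (1 - gamma))%:E.
Proof.
move=> g1 fC t x.
have g1' : (0 < 1 - gamma)%R by rewrite subr_gt0.
have C0 : (0 <= C)%R by rewrite -lee_fin (le_trans (f0 x)).
have K0 : (0 <= C / (1 - gamma))%R by rewrite divr_ge0// ltW.
apply: lime_le; first exact: Qn_cvg.
exists 0%N => // n _ /=; elim: n t x => [|n IH] t x /=.
  by rewrite (le_trans (fC x))// lee_fin ler_pdivlMr// ler_piMr// gerBl.
have -> : (C / (1 - gamma))%:E = bellman (fun=> C%:E) (fun=> (C / (1 - gamma))%:E) x.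
  rewrite /bellman integral_cst// prob_kernel mule1 -EFinM -EFinD; congr EFin.
  have u : (1 - gamma)%R \is a GRing.unit by rewrite unitfE gt_eqF.
  apply: (mulIr u); rewrite mulrDl mulrA !divrK//.
  by rewrite mulrBr mulr1 mulrC subrK.
apply: le_bellman => //.
- by move=> s; exact: act_ge0.
- exact: measurable_act.
- by move=> s; rewrite -(act_cst (pi t.+1) _ s); apply: le_act => //.
Qed.

End props.

Section monotone.
Variables f g : X * Y -> \bar R.
Hypotheses (f0 : forall x, 0 <= f x) (mf : measurable_fun setT f).
Hypotheses (g0 : forall x, 0 <= g x) (mg : measurable_fun setT g).
Hypothesis fg : forall x, f x <= g x.

Lemma le_Qn_reward n t x : Qn f n t x <= Qn g n t x.
Proof.
elim: n t x => [|n IH] t x //=; apply: le_bellman => //.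
- by move=> s; apply: act_ge0; exact: Qn_ge0.
- by apply: measurable_act; [exact: Qn_ge0|exact: measurable_Qn].
- by move=> s; apply: act_ge0; exact: Qn_ge0.
- by apply: measurable_act; [exact: Qn_ge0|exact: measurable_Qn].
- by move=> s; apply: le_act => //; solve [exact: Qn_ge0|exact: measurable_Qn].
Qed.

Lemma le_QT_reward T t x : QT f T t x <= QT g T t x.
Proof.
case: T => [N|]; first exact: le_Qn_reward.
apply: lee_lim; [exact: Qn_cvg|exact: Qn_cvg|].
by exists 0%N => // n _; exact: le_Qn_reward.
Qed.

End monotone.
End nonneg_values.

(** * Expected returns along trajectories as solutions of the Bellman recursion *)

Section trajectories.
Context {R : realType} {dX dY : measure_display}
  {X : measurableType dX} {Y : measurableType dY}.
Variables (P : R.-pker (X * Y) ~> X) (gamma : R).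
Hypothesis gamma0 : 0 <= gamma.
Variable pi : nat -> R.-pker X ~> Y.
Local Open Scope ereal_scope.

Lemma integral_pkcomp {d1 d2 d3} {X1 : measurableType d1}
    {X2 : measurableType d2} {X3 : measurableType d3}
    (l : R.-pker X1 ~> X2) (k : R.-pker (X1 * X2) ~> X3) x (F : X3 -> \bar R) :
  (forall z, 0 <= F z) -> measurable_fun setT F ->
  \int[pkcomp l k x]_z F z = \int[l x]_y \int[k (x, y)]_z F z.
Proof. exact: integral_kcomp. Qed.

(** Unfolds the three nested kernel compositions of [traj]; the last kernel is a Dirac mass that
    glues [x] in front of the trajectory. *)
Lemma integral_trajS n t x (F : n.+2.-tuple (X * Y) -> \bar R) :
  (forall tau, 0 <= F tau) -> measurable_fun setT F ->
  \int[traj P pi n.+1 t x]_tau F tau =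
  \int[P x]_s \int[pi t.+1 s]_a
    \int[traj P pi n t.+1 (s, a)]_tau F [tuple of x :: tau].
Proof.
move=> F0 mF; rewrite /= integral_pkcomp//; apply: eq_integral => s _.
rewrite integral_pkcomp//; apply: eq_integral => a _.
rewrite integral_pkcomp//; apply: eq_integral => tau _.
by rewrite integral_dirac// diracT mul1e.
Qed.

Lemma disc_return_cons (r : X * Y -> R) n x (tau : n.+1.-tuple (X * Y)) :
  disc_return r gamma [tuple of x :: tau] =
  (r x + gamma * disc_return r gamma tau)%R.
Proof.
rewrite /disc_return big_ord_recl expr0 mul1r tnth0 big_distrr; congr (_ + _)%R.
by apply: eq_bigr => i _; rewrite tnthS exprS /= mulrA.
Qed.

Lemma measurable_disc_return (r : X * Y -> R) n :
  measurable_fun setT r -> measurable_fun setT (@disc_return R _ _ X Y r gamma n).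
Proof.
move=> mr; apply: measurable_sum => k; apply: measurable_funM => //.
by apply: measurableT_comp => //; exact: measurable_tnth.
Qed.

Lemma disc_return_ge0 (r : X * Y -> R) n (tau : n.+1.-tuple (X * Y)) :
  (forall x, 0 <= r x)%R -> (0 <= disc_return r gamma tau)%R.
Proof. by move=> r0; apply: sumr_ge0 => k _; rewrite mulr_ge0// exprn_ge0. Qed.

(** By [disc_return_cons] the return is an affine function of the return from the next stage, and
    affine functions commute with means under probability measures. *)
Lemma integral_disc_return (r : X * Y -> R) n t x :
  (forall x, 0 <= r x)%R -> measurable_fun setT r ->
  \int[traj P pi n t x]_tau (disc_return r gamma tau)%:E =
  Qn P gamma pi (EFin \o r) n t x.
Proof.
move=> r0 mr; have mrE : measurable_fun setT (EFin \o r) by exact/measurable_EFinP.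
have mE m : measurable_fun setT (fun tau => (@disc_return R _ _ X Y r gamma m tau)%:E).
  by apply/measurable_EFinP; exact: measurable_disc_return.
elim: n t x => [|n IH] t x.
  rewrite integral_dirac//; last exact: mE.
  rewrite diracT mul1e /disc_return big_ord1 expr0 mul1r.
  by rewrite tnth0.
rewrite integral_trajS//; last by move=> tau; rewrite lee_fin disc_return_ge0.
rewrite [RHS]/= /bellman.
pose V s := act (pi t.+1) (Qn P gamma pi (EFin \o r) n t.+1) s.
have V0 s : 0 <= V s by apply: act_ge0 => y; exact: Qn_ge0.
have Q0 m t' y : 0 <= Qn P gamma pi (EFin \o r) m t' y by exact: Qn_ge0.
have mQ m t' : measurable_fun setT (Qn P gamma pi (EFin \o r) m t').
  exact: measurable_Qn.
have mV : measurable_fun setT V by exact: measurable_act.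
(* Used three times: for the next state, the next action and the remaining trajectory. *)
have affine d (Z : measurableType d) (mu : {measure set Z -> \bar R}) (F : Z -> \bar R) :
    mu setT = 1 -> (forall z, 0 <= F z) -> measurable_fun setT F ->
    \int[mu]_z ((r x)%:E + gamma%:E * F z) = (r x)%:E + gamma%:E * \int[mu]_z F z.
  move=> mu1 F0 mF; rewrite ge0_integralD//.
  - by rewrite integral_cst// mu1 mule1 ge0_integralZl_EFin.
  - by move=> z _; rewrite lee_fin.
  - by move=> z _; rewrite mule_ge0 ?lee_fin.
  - exact: measurable_funeM.
transitivity (\int[P x]_s ((r x)%:E + gamma%:E * V s)); last first.
  by apply: affine => //; exact: prob_kernel.
apply: eq_integral => s _.
transitivity (\int[pi t.+1 s]_a
  ((r x)%:E + gamma%:E * Qn P gamma pi (EFin \o r) n t.+1 (s, a))); last first.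
  by apply: affine => //; [exact: prob_kernel|exact: measurableT_comp].
apply: eq_integral => a _; rewrite -IH.
rewrite -affine//.
- by apply: eq_integral => tau _; rewrite disc_return_cons EFinD EFinM.
- exact: prob_kernel.
- by move=> tau; rewrite lee_fin disc_return_ge0.
- exact: mE.
Qed.

Lemma Qfun_ge0E (r : X * Y -> R) T t x :
  (forall x, 0 <= r x)%R -> measurable_fun setT r ->
  Qfun P r gamma pi T t x = QT P gamma pi (EFin \o r) T t x.
Proof.
move=> r0 mr; case: T => [N|] /=; first exact: integral_disc_return.
by congr (limn _); apply/funext => n; exact: integral_disc_return.
Qed.

Section difference.
Variables r p q : X * Y -> R.
Hypotheses (p0 : forall x, (0 <= p x)%R) (mp : measurable_fun setT p).
Hypotheses (q0 : forall x, (0 <= q x)%R) (mq : measurable_fun setT q).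
Hypothesis rpq : forall x, r x = (p x - q x)%R.

Lemma integral_disc_returnB n t x :
  Qn P gamma pi (EFin \o p) n t x < +oo -> Qn P gamma pi (EFin \o q) n t x < +oo ->
  \int[traj P pi n t x]_tau (disc_return r gamma tau)%:E =
  Qn P gamma pi (EFin \o p) n t x - Qn P gamma pi (EFin \o q) n t x.
Proof.
have int (h : X * Y -> R) : (forall x, (0 <= h x)%R) -> measurable_fun setT h ->
    Qn P gamma pi (EFin \o h) n t x < +oo ->
    (traj P pi n t x).-integrable setT (fun tau => (@disc_return R _ _ X Y h gamma n tau)%:E).
  move=> h0 mh hoo; apply/integrableP; split.
    by apply/measurable_EFinP; exact: measurable_disc_return.
  under eq_integral do rewrite /= ger0_norm ?disc_return_ge0//.
  by rewrite integral_disc_return.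
move=> poo qoo; rewrite -!integral_disc_return// -integralB_EFin//; try exact: int.
apply: eq_integral => tau _; rewrite -EFinB -sumrB; congr EFin.
by apply: eq_bigr => k _; rewrite rpq mulrBr.
Qed.

(** Finiteness of the two nonnegative values excludes +oo - +oo. By monotonicity in n it holds at
    every finite stage, so the split of [r] survives both there and in the limit. *)
Lemma QfunB T t x :
  QT P gamma pi (EFin \o p) T t x < +oo -> QT P gamma pi (EFin \o q) T t x < +oo ->
  Qfun P r gamma pi T t x =
  QT P gamma pi (EFin \o p) T t x - QT P gamma pi (EFin \o q) T t x.
Proof.
case: T => [N|]; first exact: integral_disc_returnB.
move=> poo qoo; apply/cvg_lim => //.
have Qlim (h : X * Y -> R) : (forall x, (0 <= h x)%R) -> measurable_fun setT h ->
    Qn P gamma pi (EFin \o h) n t x @[n --> \oo] --> QT P gamma pi (EFin \o h) None t x.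
  by move=> h0 mh; apply: Qn_cvg => //; exact/measurable_EFinP.
have Qfin (h : X * Y -> R) : (forall x, (0 <= h x)%R) -> measurable_fun setT h ->
    QT P gamma pi (EFin \o h) None t x < +oo ->
    forall n, Qn P gamma pi (EFin \o h) n t x < +oo.
  move=> h0 mh; move/[swap] => n; apply: le_lt_trans; apply: Qn_le_QT => //.
  exact/measurable_EFinP.
under eq_cvg do rewrite integral_disc_returnB ?Qfin//.
apply: cvgeB; [|exact: Qlim|exact: Qlim].
apply: fin_num_adde_defl; rewrite fin_numN ge0_fin_numE//.
by apply: QT_ge0 => //; exact/measurable_EFinP.
Qed.

(** Serves the almost-everywhere argument of [VfunB]: for a finite horizon [QfunB] may fail at some
    points and cannot give measurability. The positive and negative parts of the return itself are
    used instead. *)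
Lemma measurable_Qfun_finite N t :
  measurable_fun setT (Qfun P r gamma pi (Some N) t).
Proof.
have mr : measurable_fun setT r.
  by rewrite (_ : r = p \- q)%R; [exact: measurable_funB|exact/funext].
pose D (tau : (N - t).+1.-tuple (X * Y)) := (disc_return r gamma tau)%:E.
have mD : measurable_fun setT D.
  by apply/measurable_EFinP; exact: measurable_disc_return.
rewrite (_ : Qfun _ _ _ _ _ _ = (fun x => \int[traj P pi (N - t) t x]_tau D^\+ tau)
    \- (fun x => \int[traj P pi (N - t) t x]_tau D^\- tau)); last first.
  by apply/funext => x; rewrite /Qfun integralE.
have mI (F : _ -> \bar R) : (forall tau, 0 <= F tau) -> measurable_fun setT F ->
    measurable_fun setT (fun x => \int[traj P pi (N - t) t x]_tau F tau).
  by apply: measurable_fun_integral_kernel => U mU; exact: measurable_kernel.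
apply: emeasurable_funB; apply: mI.
- by move=> tau; exact: funepos_ge0.
- exact: measurable_funepos.
- by move=> tau; exact: funeneg_ge0.
- exact: measurable_funeneg.
Qed.

End difference.
End trajectories.

(** * Hyper-values as means of ordinary values under the modes *)

Section hyper_values.
Context {R : realType} {dS dA : measure_display}
  {S : measurableType dS} {A : measurableType dA} {M : nat}.
Variables (P : R.-pker (S * A) ~> S) (phi : 'I_M.+1 -> R.-pker S ~> A).
Variable gamma : R.
Hypothesis gamma0 : 0 <= gamma.
Local Open Scope ereal_scope.

Definition hyper (f : S * A -> \bar R) (x : S * 'I_M.+1) : \bar R :=
  act (phi x.2) f x.1.

Section props.
Variable f : S * A -> \bar R.
Hypotheses (f0 : forall x, 0 <= f x) (mf : measurable_fun setT f).

Lemma hyper_ge0 x : 0 <= hyper f x.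
Proof. exact: act_ge0. Qed.

Lemma measurable_hyper : measurable_fun setT (hyper f).
Proof.
move=> _ B mB; rewrite setTI; apply: measurable_mode_pair => u.
by rewrite -[X in measurable X]setTI; exact: (measurable_act (phi u) f0 mf).
Qed.

Lemma act_composite (zeta : R.-pker S ~> 'I_M.+1) s :
  act (composite phi zeta) f s = act zeta (hyper f) s.
Proof.
rewrite /act integral_pkcomp//.
exact: measurableT_comp.
Qed.

Lemma act_composite_kdirac (g : S -> 'I_M.+1) (mg : measurable_fun setT g) s :
  act (composite phi (kdirac mg)) f s = hyper f (s, g s).
Proof.
by rewrite act_composite /act integral_dirac// diracT mul1e.
Qed.

(** [hyper_trans] is the mean of [P] under the mode, so averaging the continuation term over the
    mode amounts to integrating [W] against [hyper_trans]. *)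
Lemma hyper_bellman W x : (forall s, 0 <= W s) -> measurable_fun setT W ->
  hyper (bellman P gamma f W) x = bellman (hyper_trans P phi) gamma (hyper f) W x.
Proof.
case: x => s u W0 mW; have PW0 a : 0 <= \int[P (s, a)]_s' W s'.
  by apply: integral_ge0.
have mPW : measurable_fun setT (fun a => \int[P (s, a)]_s' W s').
  apply: (measurableT_comp (f := fun x => \int[P x]_s' W s')) => //.
  by apply: measurable_fun_integral_kernel => // U mU; exact: measurable_kernel.
rewrite /hyper /bellman /act /= ge0_integralD//.
- by rewrite ge0_integralZl_EFin//; congr (_ + _ * _); rewrite integral_pkcomp.
- exact: measurableT_comp.
- by move=> a _; rewrite mule_ge0 ?lee_fin.
- exact: measurable_funeM.
Qed.

Variables (zeta : R.-pker S ~> 'I_M.+1) (pi : R.-pker S ~> A).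
Hypothesis piE : forall s B, measurable B -> pi s B = composite phi zeta s B.

Lemma act_mixture s : act pi f s = act zeta (hyper f) s.
Proof.
rewrite -act_composite; apply: eq_measure_integral => B mB _; exact: piE.
Qed.

End props.

Section behaviour.
Variable f : S * A -> \bar R.
Hypotheses (f0 : forall x, 0 <= f x) (mf : measurable_fun setT f).
Variables (zeta : R.-pker S ~> 'I_M.+1) (pi : R.-pker S ~> A).
Hypothesis piE : forall s B, measurable B -> pi s B = composite phi zeta s B.

(** Induction with [hyper_bellman]. The values at the next stage agree because acting with [pi]
    amounts to drawing a mode from [zeta] and acting with that mode, which is [act_mixture]. *)
Lemma hyper_Qn n t :
  Qn (hyper_trans P phi) gamma (fun=> zeta) (hyper f) n t =
  hyper (Qn P gamma (fun=> pi) f n t).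
Proof.
elim: n t => [|n IH] t //=; apply/funext => x.
have Q0 y : 0 <= Qn P gamma (fun=> pi) f n t.+1 y by exact: Qn_ge0.
have mQ : measurable_fun setT (Qn P gamma (fun=> pi) f n t.+1) by exact: measurable_Qn.
rewrite hyper_bellman//.
- rewrite IH; congr (bellman _ _ _ _ _); apply/funext => s.
  by rewrite -(act_mixture _ _ piE).
- by move=> s; exact: act_ge0.
- exact: measurable_act.
Qed.

Lemma hyper_QT T t :
  QT (hyper_trans P phi) gamma (fun=> zeta) (hyper f) T t =
  hyper (QT P gamma (fun=> pi) f T t).
Proof.
apply/funext => x; case: T => [N|]; rewrite /QT; first by rewrite hyper_Qn.
under eq_fun do rewrite hyper_Qn.
by apply/cvg_lim => //; exact: act_QT_cvg.
Qed.

End behaviour.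
End hyper_values.

(** * One step of the improvement inequality, in additive form *)

Section one_step.
Context {R : realType} {dS dA : measure_display}
  {S : measurableType dS} {A : measurableType dA} {M : nat}.
Local Open Scope ereal_scope.

(** Add the two inequalities and cancel x + y, which is finite. If [b] or [h] is +oo the conclusion
    is trivial; otherwise the hypotheses force [a] and [g] to be finite. *)
Lemma lee_add_cancel (a b g h : \bar R) (x y c : R) :
  0 <= a -> 0 <= b -> 0 <= g -> 0 <= h ->
  a + y%:E <= b + x%:E -> x%:E + g <= h + y%:E + c%:E -> a + g <= h + b + c%:E.
Proof.
case: a b g h => [a| |] [b| |] [g| |] [h| |]//; rewrite -?EFinD ?lee_fin//= => *; last 3 first.
- exact: leey.
- exact: leey.
- exact: leey.
lra.
Qed.

Lemma integral_addc d (Z : measurableType d) (mu : {measure set Z -> \bar R})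
    (F : Z -> \bar R) (c : R) : mu setT = 1 -> (0 <= c)%R ->
  (forall z, 0 <= F z) -> measurable_fun setT F ->
  \int[mu]_z (F z + c%:E) = \int[mu]_z F z + c%:E.
Proof.
move=> mu1 c0 F0 mF; rewrite ge0_integralD//.
by rewrite integral_cst// mu1 mule1.
Qed.

Lemma le_integral_exchange d (Z : measurableType d)
    (mu : {measure set Z -> \bar R}) (F F' G G' : Z -> \bar R) (c : R) :
  mu setT = 1 -> (0 <= c)%R ->
  (forall z, 0 <= F z) -> measurable_fun setT F ->
  (forall z, 0 <= F' z) -> measurable_fun setT F' ->
  (forall z, 0 <= G z) -> measurable_fun setT G ->
  (forall z, 0 <= G' z) -> measurable_fun setT G' ->
  (forall z, F z + F' z <= G z + G' z + c%:E) ->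
  \int[mu]_z F z + \int[mu]_z F' z <= \int[mu]_z G z + \int[mu]_z G' z + c%:E.
Proof.
move=> mu1 c0 F0 mF F'0 mF' G0 mG G'0 mG' le_c.
have FF'0 z : 0 <= F z + F' z by exact: adde_ge0.
have GG'0 z : 0 <= G z + G' z by exact: adde_ge0.
have mFF' : measurable_fun setT (fun z => F z + F' z) by exact: emeasurable_funD.
have mGG' : measurable_fun setT (fun z => G z + G' z) by exact: emeasurable_funD.
rewrite -!ge0_integralD// -integral_addc//; apply: ge0_le_integral => //.
exact: emeasurable_funD.
Qed.

(** The immediate rewards p x + q x are the same on both sides, so only the discounted continuation
    terms are compared; this is where the error gains a factor [gamma]. *)
Lemma le_bellman_exchange (P : R.-pker (S * A) ~> S) (gamma : R)
    (p q : S * A -> \bar R) (W W' U U' : S -> \bar R) (c : R) x :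
  (0 <= gamma)%R -> (0 <= c)%R ->
  (forall s, 0 <= W s) -> measurable_fun setT W ->
  (forall s, 0 <= W' s) -> measurable_fun setT W' ->
  (forall s, 0 <= U s) -> measurable_fun setT U ->
  (forall s, 0 <= U' s) -> measurable_fun setT U' ->
  (forall s, W s + W' s <= U s + U' s + c%:E) ->
  bellman P gamma p W x + bellman P gamma q W' x <=
  bellman P gamma p U x + bellman P gamma q U' x + (gamma * c)%:E.
Proof.
move=> g0 c0 W0 mW W'0 mW' U0 mU U'0 mU' le_c.
have I0 (F : S -> \bar R) : (forall s, 0 <= F s) -> 0 <= \int[P x]_s F s.
  by move=> F0; exact: integral_ge0.
have IW := I0 _ W0; have IW' := I0 _ W'0.
have IU := I0 _ U0; have IU' := I0 _ U'0.
have IUU' := adde_ge0 IU IU'.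
rewrite /bellman addeACA [X in _ <= X + _]addeACA -[leRHS]addeA; apply: leeD2l.
rewrite EFinM -!ge0_muleDr//.
apply: lee_wpmul2l; first by rewrite lee_fin.
by apply: le_integral_exchange => //; exact: prob_kernel.
Qed.

Variables (phi : 'I_M.+1 -> R.-pker S ~> A) (zeta : R.-pker S ~> 'I_M.+1).
Variables Bp Bq Gp Gq : S * A -> \bar R.
Hypotheses (Bp0 : forall x, 0 <= Bp x) (mBp : measurable_fun setT Bp).
Hypotheses (Bq0 : forall x, 0 <= Bq x) (mBq : measurable_fun setT Bq).
Hypotheses (Gp0 : forall x, 0 <= Gp x) (mGp : measurable_fun setT Gp).
Hypotheses (Gq0 : forall x, 0 <= Gq x) (mGq : measurable_fun setT Gq).

(* Averaging the greedy inequality over [zeta] and integrating the last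
   hypothesis over the mode [g] gives two inequalities; in their sum the terms
   [hyper phi Bp (s, g)] and [hyper phi Bq (s, g)] occur on both sides. *)
Lemma greedy_step s (g : 'I_M.+1) (c : R) : (0 <= c)%R ->
  hyper phi Bp (s, g) < +oo -> hyper phi Bq (s, g) < +oo ->
  (forall u, hyper phi Bp (s, u) + hyper phi Bq (s, g) <=
             hyper phi Bp (s, g) + hyper phi Bq (s, u)) ->
  (forall x, Bp x + Gq x <= Gp x + Bq x + c%:E) ->
  act zeta (hyper phi Bp) s + hyper phi Gq (s, g) <=
  hyper phi Gp (s, g) + act zeta (hyper phi Bq) s + c%:E.
Proof.
move=> c0 Bpoo Bqoo greedy le_c.
have fin f : (forall x, 0 <= f x) -> hyper phi f (s, g) < +oo ->
    exists2 b : R, (0 <= b)%R & hyper phi f (s, g) = b%:E.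
  move=> f0 foo; have h0 := hyper_ge0 phi f0 (s, g).
  exists (fine (hyper phi f (s, g))); first exact: fine_ge0.
  by rewrite fineK// ge0_fin_numE.
have transfer : hyper phi Bp (s, g) + hyper phi Gq (s, g) <=
    hyper phi Gp (s, g) + hyper phi Bq (s, g) + c%:E.
  by apply: le_integral_exchange => //; try exact: measurableT_comp;
    exact: prob_kernel.
have H0 f : (forall x, 0 <= f x) -> forall u, 0 <= hyper phi f (s, u).
  by move=> f0 u; exact: hyper_ge0.
have Hp0 := H0 _ Bp0; have Hq0 := H0 _ Bq0.
have [bp bp0 bpE] := fin _ Bp0 Bpoo.
have [bq bq0 bqE] := fin _ Bq0 Bqoo.
have mean : act zeta (hyper phi Bp) s + bq%:E <=
            act zeta (hyper phi Bq) s + bp%:E.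
  rewrite /act -!integral_addc//; try exact: prob_kernel.
  apply: ge0_le_integral => //.
  - by move=> u _; rewrite adde_ge0.
  - by move=> u _; rewrite -bpE -bqE [leRHS]addeC; exact: greedy.
move: transfer; rewrite bpE bqE => transfer.
apply: (lee_add_cancel _ _ _ _ mean transfer); try exact: act_ge0.
- by apply: act_ge0 => x; exact: hyper_ge0.
- by apply: act_ge0 => x; exact: hyper_ge0.
Qed.

End one_step.

(** * Backward induction and contraction over the horizon *)

Section improvement.
Context {R : realType} {dS dA : measure_display}
  {S : measurableType dS} {A : measurableType dA} {M : nat}.
Variables (P : R.-pker (S * A) ~> S) (phi : 'I_M.+1 -> R.-pker S ~> A).
Variable gamma : R.
Hypothesis gamma0 : 0 <= gamma.
Variables (zeta_b : R.-pker S ~> 'I_M.+1) (pi_b : R.-pker S ~> A).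
Hypothesis pi_bE :
  forall s B, measurable B -> pi_b s B = composite phi zeta_b s B.
Variables (zeta_g : nat -> S -> 'I_M.+1)
  (mzeta_g : forall t, measurable_fun [set: S] (zeta_g t)).
Let pi_g t := composite phi (kdirac (mzeta_g t)).
Local Open Scope ereal_scope.
Variables p q : S * A -> \bar R.
Hypotheses (p0 : forall x, 0 <= p x) (mp : measurable_fun setT p).
Hypotheses (q0 : forall x, 0 <= q x) (mq : measurable_fun setT q).
Variable T : option nat.

Let Qb f := QT P gamma (fun=> pi_b) f T.
Let Qg f := QT P gamma pi_g f T.
Let Vb f t := act pi_b (Qb f t).
Let Vg f t := act (pi_g t) (Qg f t).

Hypothesis Qb_fin : forall t s u, in_horizon T t ->
  hyper phi (Qb p t) (s, u) < +oo /\ hyper phi (Qb q t) (s, u) < +oo.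
Hypothesis greedy : forall t s u, in_horizon T t ->
  hyper phi (Qb p t) (s, u) + hyper phi (Qb q t) (s, zeta_g t s) <=
  hyper phi (Qb p t) (s, zeta_g t s) + hyper phi (Qb q t) (s, u).

Lemma improvement_step t (e : R) : (0 <= e)%R -> in_horizon T t ->
  (in_horizon T t.+1 -> forall s,
    Vb p t.+1 s + Vg q t.+1 s <= Vg p t.+1 s + Vb q t.+1 s + e%:E) ->
  forall s, Vb p t s + Vg q t s <= Vg p t s + Vb q t s + (gamma * e)%:E.
Proof.
move=> e0 tT le_e s; rewrite /Vb /Vg /Qb /Qg.
have Q0 pi f : (forall x, 0 <= f x) -> measurable_fun setT f ->
    forall x, 0 <= QT P gamma pi f T t x.
  by move=> f0 mf x; exact: QT_ge0.
have mQ pi f : (forall x, 0 <= f x) -> measurable_fun setT f ->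
    measurable_fun setT (QT P gamma pi f T t).
  by move=> f0 mf; exact: measurable_QT.
rewrite (act_mixture (Q0 _ _ p0 mp) (mQ _ _ p0 mp) pi_bE).
rewrite (act_mixture (Q0 _ _ q0 mq) (mQ _ _ q0 mq) pi_bE).
rewrite (act_composite_kdirac phi (Q0 _ _ p0 mp) (mQ _ _ p0 mp)).
rewrite (act_composite_kdirac phi (Q0 _ _ q0 mq) (mQ _ _ q0 mq)).
apply: greedy_step.
- exact: Q0.
- exact: mQ.
- exact: Q0.
- exact: mQ.
- exact: Q0.
- exact: mQ.
- exact: Q0.
- exact: mQ.
- exact: mulr_ge0.
- exact: (Qb_fin _ _ tT).1.
- exact: (Qb_fin _ _ tT).2.
- by move=> u; exact: greedy.
move=> x; rewrite 4?QT_bellman//.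
have tail0 pi f : (forall x, 0 <= f x) -> measurable_fun setT f ->
    forall s, 0 <= tail P gamma pi f T t.+1 s.
  by move=> f0 mf s'; exact: tail_ge0.
have mtail pi f : (forall x, 0 <= f x) -> measurable_fun setT f ->
    measurable_fun setT (tail P gamma pi f T t.+1).
  by move=> f0 mf; exact: measurable_tail.
apply: le_bellman_exchange => //.
- exact: tail0.
- exact: mtail.
- exact: tail0.
- exact: mtail.
- exact: tail0.
- exact: mtail.
- exact: tail0.
- exact: mtail.
(* Past the horizon all four tails are 0 and the inequality reduces to 0 <= e. *)
move=> s'; rewrite /tail; move: le_e.
case: (in_horizon T t.+1) => [/(_ isT)|_]; first exact.
by rewrite !add0e.
Qed.

Lemma improvement_finite N t s : T = Some N -> (t <= N)%N ->
  Vb p t s + Vg q t s <= Vg p t s + Vb q t s.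
Proof.
(* Induction on an upper bound k for the number of stages left. For k = 0, t = N and the premise
   about stage t + 1 is vacuous. *)
move=> TN; move: {2}(N - t)%N (leqnn (N - t)%N) => k.
have horizon t' : (t' <= N)%N -> in_horizon T t' by rewrite TN.
elim: k t s => [|k IH] t s tk tN; rewrite -[leRHS]adde0;
    have := @improvement_step t 0 (lexx _) (horizon _ tN); rewrite mulr0; apply.
  by rewrite TN /= => tN1; lia.
by rewrite TN /= => tN1 s'; rewrite adde0; apply: IH => //; lia.
Qed.

(** With no last stage to start from, the starting point is a crude uniform error, which k
    applications of [improvement_step] shrink by gamma^k. *)
Lemma improvement_infinite (C : R) t s : T = None -> (gamma < 1)%R ->
  (forall x, p x <= C%:E) -> (forall x, q x <= C%:E) ->
  Vb p t s + Vg q t s <= Vg p t s + Vb q t s.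
Proof.
move=> TN g1 pC qC.
have horizon t' : in_horizon T t' by rewrite TN.
have C0 : (0 <= C)%R by rewrite -lee_fin (le_trans (p0 (s, point))).
have d0 : (0 < 1 - gamma)%R by rewrite subr_gt0.
set K : R := (C / (1 - gamma))%R.
have K0 : (0 <= K)%R by rewrite divr_ge0// ltW.
have le_K (pi : nat -> R.-pker S ~> A) f t' s' : (forall x, 0 <= f x) ->
    measurable_fun setT f -> (forall x, f x <= C%:E) ->
    act (pi t') (QT P gamma pi f T t') s' <= K%:E.
  move=> f0 mf fC; rewrite -(act_cst (pi t') K s') TN; apply: le_act => //.
  - by move=> x; exact: QT_ge0.
  - exact: measurable_QT.
  - by move=> x; exact: QT_ub.
have V0 (pi : nat -> R.-pker S ~> A) f t' s' : (forall x, 0 <= f x) ->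
    measurable_fun setT f -> 0 <= act (pi t') (QT P gamma pi f T t') s'.
  by move=> f0 mf; apply: act_ge0 => x; exact: QT_ge0.
(* For k = 0 the error K + K suffices: each term on the left is at most K and those on the right are
   nonnegative. *)
have approx k t' s' : Vb p t' s' + Vg q t' s' <=
    Vg p t' s' + Vb q t' s' + (gamma ^+ k * (K + K))%:E.
  elim: k t' s' => [|k IH] t' s'.
    rewrite expr0 mul1r EFinD -[leLHS]add0e; apply: leeD.
      by rewrite adde_ge0//; [exact: V0|exact: (V0 (fun=> pi_b))].
    by apply: leeD; [exact: (le_K (fun=> pi_b))|exact: le_K].
  rewrite exprS -mulrA; apply: improvement_step => //.
  by rewrite mulr_ge0 ?exprn_ge0 ?addr_ge0.
apply/lee_addgt0Pr => e e0.
have : (gamma ^+ k * (K + K))%R @[k --> \oo] --> (0%R : R).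
  rewrite -(mul0r (K + K)%R); apply: cvgMr_tmp.
  by apply: cvg_expr; rewrite ger0_norm.
move=> /(cvgr_lt _) /(_ _ e0) [k _ /(_ _ (leqnn k)) ke].
apply: le_trans (approx k t s) _; apply: leeD2l.
by rewrite lee_fin ltW.
Qed.

Lemma improvement (C : R) t s : in_horizon T t ->
  (T = None -> (gamma < 1)%R /\
    (forall x, p x <= C%:E) /\ (forall x, q x <= C%:E)) ->
  Vb p t s + Vg q t s <= Vg p t s + Vb q t s.
Proof.
case TE: T => [N|] tT bounded; first exact: improvement_finite TE tT.
by have [//|g1 [pC qC]] := bounded; exact: improvement_infinite pC qC.
Qed.

End improvement.

(** * Values of signed rewards as differences of nonnegative ones *)

Section signed_values.
Context {R : realType} {dX dY : measure_display}
  {X : measurableType dX} {Y : measurableType dY}.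
Variables (P : R.-pker (X * Y) ~> X) (gamma : R).
Hypothesis gamma0 : 0 <= gamma.
Variable pi : nat -> R.-pker X ~> Y.
Variables r p q : X * Y -> R.
Hypotheses (p0 : forall x, 0 <= p x) (mp : measurable_fun setT p).
Hypotheses (q0 : forall x, 0 <= q x) (mq : measurable_fun setT q).
Hypothesis rpq : forall x, r x = p x - q x.
Local Open Scope ereal_scope.

Let Qp := QT P gamma pi (EFin \o p).
Let Qq := QT P gamma pi (EFin \o q).

(* [QfunB] applies only where [Qp] and [Qq] are finite, i.e. almost everywhere. *)
Lemma VfunB T t s :
  (T = None -> forall x, Qp T t x < +oo /\ Qq T t x < +oo) ->
  act (pi t) (Qp T t) s < +oo -> act (pi t) (Qq T t) s < +oo ->
  Vfun P r gamma pi T t s = act (pi t) (Qp T t) s - act (pi t) (Qq T t) s.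
Proof.
move=> finT poo qoo.
have mpE : measurable_fun setT (EFin \o p) by exact/measurable_EFinP.
have mqE : measurable_fun setT (EFin \o q) by exact/measurable_EFinP.
have Qp0 x : 0 <= Qp T t x by exact: QT_ge0.
have Qq0 x : 0 <= Qq T t x by exact: QT_ge0.
have mQp : measurable_fun setT (Qp T t) by exact: measurable_QT.
have mQq : measurable_fun setT (Qq T t) by exact: measurable_QT.
have QB x : Qp T t x < +oo -> Qq T t x < +oo ->
    Qfun P r gamma pi T t x = Qp T t x - Qq T t x by exact: QfunB.
have mQ : measurable_fun setT (Qfun P r gamma pi T t).
  case: T => [N|] in finT poo qoo Qp0 Qq0 mQp mQq QB *.
    exact: measurable_Qfun_finite mp mq rpq _ _.
  rewrite (_ : Qfun _ _ _ _ _ _ = Qp None t \- Qq None t).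
    exact: emeasurable_funB.
  by apply/funext => x; have [//|? ?] := finT _ x; rewrite QB.
have msec f : measurable_fun setT f ->
    measurable_fun setT (fun a : Y => f (s, a) : \bar R).
  by move=> mf; exact: measurableT_comp.
have int f : (forall x, 0 <= f x) -> measurable_fun setT f ->
    act (pi t) f s < +oo -> (pi t s).-integrable setT (fun a => f (s, a)).
  move=> f0 mf foo; apply/integrableP; split; first exact: msec.
  by under eq_integral do rewrite gee0_abs//.
have intp := int _ Qp0 mQp poo; have intq := int _ Qq0 mQq qoo.
rewrite /act -integralB//.
apply: ae_eq_integral => //; [exact: msec|by apply: emeasurable_funB; exact: msec|].
have := integrable_ae measurableT intq.
apply: filterS2 (integrable_ae measurableT intp) => a ap aq _.
by apply: QB; rewrite -ge0_fin_numE//; [exact: ap|exact: aq].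
Qed.

End signed_values.

Lemma leeBBE {R : realType} (a b c d : \bar R) :
  a \is a fin_num -> b \is a fin_num -> c \is a fin_num -> d \is a fin_num ->
  (a - b <= c - d)%E = (a + d <= c + b)%E.
Proof.
case: a b c d => [a| |] [b| |] [c| |] [d| |]// _ _ _ _.
by rewrite -!EFinB -!EFinD !lee_fin; apply/idP/idP => ?; lra.
Qed.

(** * From the greedy condition on signed hyper-values to policy improvement *)

Section greedy_improvement.
Context {R : realType} {dS dA : measure_display}
  {S : measurableType dS} {A : measurableType dA} {M : nat}.
Variables (P : R.-pker (S * A) ~> S) (phi : 'I_M.+1 -> R.-pker S ~> A).
Variables (r : S * A -> R) (gamma : R) (T : option nat).
Variables (zeta_b : R.-pker S ~> 'I_M.+1) (pi_b : R.-pker S ~> A).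
Variables (zeta_g : nat -> S -> 'I_M.+1)
  (mzeta_g : forall t, measurable_fun [set: S] (zeta_g t)).
Let pi_g t := composite phi (kdirac (mzeta_g t)).
Let QH := Qfun (hyper_trans P phi) (hyper_reward r phi) gamma (fun=> zeta_b) T.
Let abs_r x := `|r x|.
Local Open Scope ereal_scope.
Hypothesis mr : measurable_fun setT r.
Hypothesis gamma0 : (0 <= gamma)%R.
Hypothesis pi_bE :
  forall s B, measurable B -> pi_b s B = composite phi zeta_b s B.
Hypothesis greedy : forall t s u, in_horizon T t ->
  QH t (s, u) <= QH t (s, zeta_g t s).
Hypothesis fin_finite : forall N, T = Some N -> forall t s, (t <= N)%N ->
  (forall u, \int[phi u s]_a
     Qfun P abs_r gamma (fun=> pi_b) T t (s, a) < +oo) /\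
  Vfun P abs_r gamma pi_g T t s < +oo.
Hypothesis fin_infinite :
  T = None -> (gamma < 1)%R /\ exists C, forall x, (`|r x| <= C)%R.

Let Q pi (h : S * A -> R) := QT P gamma pi (EFin \o h) T.
Let b : nat -> R.-pker S ~> A := fun=> pi_b.
(** A common class for [abs_r], [p] and [q], so that the finiteness assumed for [abs_r] is
    transferred to all three at once. *)
Let dominated (h : S * A -> R) :=
  [/\ forall x, (0 <= h x)%R, measurable_fun setT h &
      forall x, (h x <= abs_r x)%R].

Let p := (r^\+)%R.
Let q := (r^\-)%R.

Let dominated_abs : dominated abs_r.
Proof. by split=> [x||x]; [exact: normr_ge0|exact: measurableT_comp|]. Qed.

Let dominated_p : dominated p.
Proof.
split=> [x||x]; [exact: funrpos_ge0|exact: measurable_funrpos|].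
by rewrite /p /abs_r /funrpos ge_max ler_norm normr_ge0.
Qed.

Let dominated_q : dominated q.
Proof.
split=> [x||x]; [exact: funrneg_ge0|exact: measurable_funrneg|].
by rewrite /q /abs_r /funrneg ge_max -normrN ler_norm normr_ge0.
Qed.

Let rpq x : r x = (p x - q x)%R.
Proof. by rewrite -{1}(funrposBneg r). Qed.

Let dominatedE h : dominated h ->
  (forall x, 0 <= (EFin \o h) x) /\ measurable_fun setT (EFin \o h).
Proof. by case=> h0 mh _; split=> [x|]; [rewrite lee_fin|exact/measurable_EFinP]. Qed.

Let Q_ge0 pi h t x : dominated h -> 0 <= Q pi h t x.
Proof. by move=> /dominatedE[h0 mh]; exact: QT_ge0. Qed.

Let measurable_Q pi h t : dominated h -> measurable_fun setT (Q pi h t).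
Proof. by move=> /dominatedE[h0 mh]; exact: measurable_QT. Qed.

Let QfunE_abs pi t : Qfun P abs_r gamma pi T t = Q pi abs_r t.
Proof.
by have [a0 ma _] := dominated_abs; apply/funext => x; exact: Qfun_ge0E.
Qed.

Let le_Q_abs pi h t x : dominated h -> Q pi h t x <= Q pi abs_r t x.
Proof.
move=> hg; have [h0 mh] := dominatedE hg; have [a0 ma] := dominatedE dominated_abs.
by apply: le_QT_reward => // y; rewrite lee_fin; case: hg.
Qed.

Let Q_infinite pi h : T = None -> dominated h -> exists K : R,
  forall t x, Q pi h t x <= K%:E.
Proof.
move=> TN hg; have [g1 [C rC]] := fin_infinite TN.
exists (C / (1 - gamma))%R => t x; have [h0 mh] := dominatedE hg.
rewrite /Q TN; apply: QT_ub => // y; rewrite lee_fin.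
by case: hg => _ _ ha; exact: le_trans (ha y) (rC y).
Qed.

Let act_Q_infinite k pi h t s : T = None -> dominated h -> act k (Q pi h t) s < +oo.
Proof.
move=> TN hg; have [K leK] := Q_infinite pi TN hg.
apply: (@le_lt_trans _ _ K%:E); last exact: ltry.
rewrite -(act_cst k K s); apply: le_act => //.
- by move=> x; exact: Q_ge0.
- exact: measurable_Q.
- by move=> x; rewrite (le_trans (Q_ge0 pi t x hg)).
Qed.

Let hyper_Q_lty h t s u : dominated h -> in_horizon T t ->
  hyper phi (Q b h t) (s, u) < +oo.
Proof.
move=> hg tT; apply: (@le_lt_trans _ _ (hyper phi (Q b abs_r t) (s, u))).
  apply: le_act => [x||x||x]; [exact: Q_ge0|exact: measurable_Q|
    exact: Q_ge0|exact: measurable_Q|exact: le_Q_abs].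
case TE: T => [N|]; last exact: act_Q_infinite.
have tN : (t <= N)%N by move: tT; rewrite TE.
have [/(_ u) + _] := fin_finite TE s tN; rewrite /hyper /act /=.
by rewrite QfunE_abs.
Qed.

Let act_g_lty h t s : dominated h -> in_horizon T t ->
  act (pi_g t) (Q pi_g h t) s < +oo.
Proof.
move=> hg tT; apply: (@le_lt_trans _ _ (act (pi_g t) (Q pi_g abs_r t) s)).
  apply: le_act => [x||x||x]; [exact: Q_ge0|exact: measurable_Q|
    exact: Q_ge0|exact: measurable_Q|exact: le_Q_abs].
case TE: T => [N|]; last exact: act_Q_infinite.
have tN : (t <= N)%N by move: tT; rewrite TE.
have [_] := fin_finite TE s tN; rewrite /Vfun /act /=.
by rewrite QfunE_abs.
Qed.

Let act_b_lty h t s : dominated h -> in_horizon T t -> act pi_b (Q b h t) s < +oo.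
Proof.
move=> hg tT; have Q0 x : 0 <= Q b h t x by exact: Q_ge0.
have mQ : measurable_fun setT (Q b h t) by exact: measurable_Q.
rewrite (act_mixture Q0 mQ pi_bE) /act.
(* The mean under [pi_b] is a [zeta_b]-mean of finitely many finite nonnegative mode values, and
   their sum bounds each of them. *)
pose K := (\sum_(u < M.+1) fine (hyper phi (Q b h t) (s, u)))%R.
apply: (@le_lt_trans _ _ (\int[zeta_b s]_u (cst K%:E) u)); last first.
  by rewrite integral_cst// prob_kernel mule1 ltry.
apply: ge0_le_integral => //; first by move=> u _; exact: hyper_ge0.
move=> u _; rewrite /cst -[leLHS]fineK ?ge0_fin_numE ?hyper_ge0 ?hyper_Q_lty//.
rewrite lee_fin /K (bigD1 u)//= lerDl sumr_ge0// => v _.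
by rewrite fine_ge0// hyper_ge0.
Qed.

(* The positive and negative parts of the hyper-reward are not the hyper-rewards
   of [p] and [q]; but [hr p - hr q] is also a decomposition of it. *)
Let hr h x : R := fine (hyper phi (EFin \o h) x).

Let hrE h : dominated h -> EFin \o hr h = hyper phi (EFin \o h).
Proof.
move=> hg; have [h0 mh] := dominatedE hg; apply/funext => -[s u] /=.
rewrite fineK// ge0_fin_numE ?hyper_ge0//.
(* Stage 0 lies within any horizon, and there the value dominates the immediate reward; so the mean
   reward of a mode is finite and [fine] loses nothing. *)
have T0 : in_horizon T 0 by case: T.
apply: le_lt_trans (hyper_Q_lty s u hg T0).
apply: le_act; [exact: h0|exact: mh|move=> x; exact: Q_ge0|exact: measurable_Q|].
by move=> x; exact: QT_ge.
Qed.

Let hyper_rewardE x : hyper_reward r phi x = (hr p x - hr q x)%R.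
Proof.
have int h : dominated h -> (phi x.2 x.1).-integrable setT (EFin \o (fun a => h (x.1, a))).
  move=> hg; have [h0 mh] := dominatedE hg; apply/integrableP; split.
    exact: (measurableT_comp (f := EFin \o h) mh (pair1_measurable x.1)).
  rewrite (_ : integral _ _ _ = hyper phi (EFin \o h) x); first by rewrite -hrE// ltry.
  by apply: eq_integral => a _; rewrite gee0_abs//; exact: h0.
rewrite /hyper_reward (@eq_Rintegral _ _ _ _ _ (fun a => p (x.1, a) - q (x.1, a))%R).
  by rewrite RintegralB//; exact: int.
by move=> a _; exact: rpq.
Qed.

(** [QfunB] is applied in the hyper-MDP with the rewards [hr p] and [hr q], and [hyper_QT] turns the
    two resulting hyper-values into means under the mode. *)
Let QHE t s u : in_horizon T t ->
  QH t (s, u) = hyper phi (Q b p t) (s, u) - hyper phi (Q b q t) (s, u).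
Proof.
move=> tT.
have QTE h : dominated h -> QT (hyper_trans P phi) gamma (fun=> zeta_b) (EFin \o hr h) T t =
    hyper phi (Q b h t).
  by move=> hg; rewrite hrE//; have [h0 mh] := dominatedE hg; exact: hyper_QT.
have hr0 h : dominated h -> forall x, (0 <= hr h x)%R.
  by move=> hg x; have [h0 mh] := dominatedE hg; rewrite fine_ge0// hyper_ge0.
have mhr h : dominated h -> measurable_fun setT (hr h).
  move=> hg; apply/measurable_EFinP; rewrite hrE//.
  by have [h0 mh] := dominatedE hg; exact: measurable_hyper.
rewrite /QH (QfunB gamma0 (hr0 _ dominated_p) (mhr _ dominated_p) (hr0 _ dominated_q)
  (mhr _ dominated_q) hyper_rewardE) !QTE//; exact: hyper_Q_lty.
Qed.

Lemma greedy_improvement t s : in_horizon T t ->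
  Vfun P r gamma (fun=> pi_b) T t s <= Vfun P r gamma pi_g T t s.
Proof.
move=> tT; have [p0 mp _] := dominated_p; have [q0 mq _] := dominated_q.
have finN pi h : dominated h -> T = None -> forall x, Q pi h t x < +oo.
  move=> hg TN x; have [K leK] := Q_infinite pi TN hg.
  exact: le_lt_trans (leK t x) (ltry K).
have VB pi : (forall h, dominated h -> act (pi t) (Q pi h t) s < +oo) ->
    Vfun P r gamma pi T t s = act (pi t) (Q pi p t) s - act (pi t) (Q pi q t) s.
  move=> lty; apply: VfunB => //; [|exact: lty|exact: lty].
  by move=> TN x; split; exact: finN.
rewrite (VB b (fun h hg => act_b_lty s hg tT)).
rewrite (VB pi_g (fun h hg => act_g_lty s hg tT)).
have [pE0 mpE] := dominatedE dominated_p; have [qE0 mqE] := dominatedE dominated_q.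
have fin h k pi : dominated h -> act k (Q pi h t) s < +oo ->
    act k (Q pi h t) s \is a fin_num.
  by move=> hg hoo; rewrite ge0_fin_numE// act_ge0// => x; exact: Q_ge0.
(* All four mode values are finite, so the greedy inequality between differences can be rearranged
   into one between sums. *)
have greedyD t' s' u' : in_horizon T t' ->
    hyper phi (Q b p t') (s', u') + hyper phi (Q b q t') (s', zeta_g t' s') <=
    hyper phi (Q b p t') (s', zeta_g t' s') + hyper phi (Q b q t') (s', u').
  move=> t'T; have := greedy s' u' t'T; rewrite !QHE//.
  have H h v : dominated h -> hyper phi (Q b h t') (s', v) \is a fin_num.
    move=> hg; rewrite ge0_fin_numE; first exact: hyper_Q_lty.
    by apply: hyper_ge0 => x; exact: Q_ge0.
  by rewrite leeBBE//; exact: H.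
have [C bounded] : exists C : R, T = None -> (gamma < 1)%R /\
    (forall x, (EFin \o p) x <= C%:E) /\ (forall x, (EFin \o q) x <= C%:E).
  (* For a finite horizon the implication is vacuous and 0 is a placeholder. *)
  case: (pselect (T = None)) => [TN|]; last by exists 0%R.
  have [g1 [C rC]] := fin_infinite TN; exists C => _; split => //.
  split => x; rewrite lee_fin (le_trans _ (rC x))//.
    by case: dominated_p.
  by case: dominated_q.
have Qfin t' s' u' : in_horizon T t' -> hyper phi (Q b p t') (s', u') < +oo /\
    hyper phi (Q b q t') (s', u') < +oo.
  by move=> t'T; split; exact: hyper_Q_lty.
rewrite leeBBE.
- exact: (improvement gamma0 pi_bE mzeta_g pE0 mpE qE0 mqE Qfin greedyD s tT bounded).
- exact: fin dominated_p (act_b_lty s dominated_p tT).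
- exact: fin dominated_q (act_b_lty s dominated_q tT).
- exact: fin dominated_p (act_g_lty s dominated_p tT).
- exact: fin dominated_q (act_g_lty s dominated_q tT).
Qed.

End greedy_improvement.

(** * Gaussian mixture behaviour policies *)

Theorem theorem1 (R : realType) (dS : measure_display) (S : measurableType dS)
  (d M : nat) (P : R.-pker (S * d.-tuple R) ~> S) (r : S * d.-tuple R -> R)
  (gamma : R) (T : option nat)
  (alpha : 'I_M.+1 -> S -> R) (phi : 'I_M.+1 -> R.-pker S ~> d.-tuple R)
  (m : 'I_M.+1 -> S -> 'rV[R]_d) (Sigma : 'I_M.+1 -> S -> 'M[R]_d)
  (pi_b : R.-pker S ~> d.-tuple R) (zeta_b : R.-pker S ~> 'I_M.+1)
  (zeta_g : nat -> S -> 'I_M.+1)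
  (mzeta_g : forall t, measurable_fun [set: S] (zeta_g t)) :
  let pi_g := fun t => composite phi (kdirac (mzeta_g t)) in
  let Q_H := Qfun (hyper_trans P phi) (hyper_reward r phi) gamma
               (fun=> zeta_b) T in
  let abs_r := fun x => `|r x| in
  measurable_fun [set: S * d.-tuple R] r ->
  0 <= gamma <= 1 ->
  (* the mixture *)
  (forall i s, 0 <= alpha i s) ->
  (forall s, \sum_(i < M.+1) alpha i s = 1) ->
  (forall i s, is_gaussian (m i s) (Sigma i s) (phi i s)) ->
  (forall s B, measurable B ->
    pi_b s B = (\sum_(i < M.+1) (alpha i s)%:E * phi i s B)%E) ->
  (* the behavioural and the greedy hyper-policies *)
  (forall s u, zeta_b s [set u] = (alpha u s)%:E) ->
  (forall t s u, in_horizon T t -> (Q_H t (s, u) <= Q_H t (s, zeta_g t s))%E) ->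
  (* existence of the expected returns *)
  (forall N, T = Some N -> forall t s, (t <= N)%N ->
    (forall u, \int[phi u s]_a
       Qfun P abs_r gamma (fun=> pi_b) T t (s, a) < +oo)%E /\
    (Vfun P abs_r gamma pi_g T t s < +oo)%E) ->
  (T = None -> gamma < 1 /\ exists C, forall x, `|r x| <= C) ->
  forall t s, in_horizon T t ->
    (Vfun P r gamma (fun=> pi_b) T t s <= Vfun P r gamma pi_g T t s)%E.
Proof.
move=> pi_g Q_H abs_r mr /andP[gamma0 _] _ _ _ mixture zeta_bE greedy fin finN t s tT.
(* The mixing coefficients are the masses that [zeta_b] gives to single modes, so the mixture is the
   composite policy induced by [zeta_b]. *)
have pi_bE s' B : measurable B -> pi_b s' B = composite phi zeta_b s' B.
  move=> mB; rewrite compositeE// mixture//.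
  by apply: eq_bigr => u _; rewrite zeta_bE.
exact: (greedy_improvement mr gamma0 pi_bE greedy fin finN).
Qed.
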